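(* Let $(R, \mathfrak{m})$ be a complete discrete valuation ring with finite residue field $R/\mathfrak{m} = \mathbb{F}_q$, and let $P_1(t), \dots, P_r(t) \in R[t]$ be monic polynomials whose reductions modulo $\mathfrak{m}$ are distinct irreducible polynomials $\overline{P}_1(t), \dots, \overline{P}_r(t) \in \mathbb{F}_q[t]$. Then $$\lim_{n \to \infty} \mathrm{Prob}_{A \in \mathrm{Mat}_n(R)}\big(\mathrm{coker}(P_j(A)) = 0 \text{ for all } 1 \le j \le r\big) = \prod_{j=1}^{r} \prod_{i=1}^{\infty} (1 - q^{-i \deg(P_j)}).$$
   Context: $\mathrm{Mat}_n(R)$ is the set of $n \times n$ matrices over $R$. $\mathrm{Prob}_{A \in \mathrm{Mat}_n(R)}$ denotes probability with respect to the Haar measure of total mass $1$ on the compact additive group $\mathrm{Mat}_n(R)$. For a matrix $B \in \mathrm{Mat}_n(R)$, $\mathrm{coker}(B)$ is the cokernel of the $R$-linear map $B : R^n \to R^n$. *)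

(* Defs.v *)
From HB Require Import structures.
From mathcomp Require Import all_boot all_order all_algebra.
From mathcomp Require Import all_classical all_reals all_analysis.

Set Implicit Arguments.
Unset Strict Implicit.
Unset Printing Implicit Defensive.

Import Order.TTheory GRing.Theory Num.Theory.
Import numFieldNormedType.Exports.

Local Open Scope classical_set_scope.
Local Open Scope ring_scope.
Local Open Scope quotient_scope.

(* The library type [idealr R] consists of the proper ideals of R; the unit
   ideal is principal anyway, so quantifying over [idealr R] loses nothing. *)
Definition principal_ideal_domain (R : idomainType) : Prop :=
  forall I : idealr R, exists a : R,
    forall x : R, x \in I <-> exists b : R, x = b * a.

Definition maximal_ideal (R : idomainType) (M : idealr R) : Prop :=
  forall I : idealr R, {subset M <= I} -> I =i M.

Definition local_ring (R : idomainType) (m : idealr R) : Prop :=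
  maximal_ideal m /\ forall M : idealr R, maximal_ideal M -> M =i m.

(* (R, m) is a local principal ideal domain which is not a field. *)
Definition discrete_valuation_ring (R : idomainType) (m : idealr R) : Prop :=
  [/\ principal_ideal_domain R, local_ring m
    & exists2 x : R, x \in m & x != 0].

Section AdicTopology.
Context {R : idomainType} (m : idealr R).

Fixpoint ideal_exp (k : nat) : set R :=
  if k is k'.+1 then
    [set x | exists2 s : seq (R * R),
       (forall p, p \in s -> p.1 \in m /\ ideal_exp k' p.2)
       & x = \sum_(p <- s) p.1 * p.2]
  else setT.

Lemma ideal_exp0 k : ideal_exp k 0.
Proof. by case: k => [|k] //=; exists [::]; rewrite ?big_nil. Qed.

Lemma ideal_expD k x y : ideal_exp k x -> ideal_exp k y -> ideal_exp k (x + y).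
Proof.
case: k => [|k] //= [s Hs ->] [t Ht ->]; exists (s ++ t); last by rewrite big_cat.
by move=> p; rewrite mem_cat => /orP [/Hs|/Ht].
Qed.

Lemma ideal_expM k a x : ideal_exp k x -> ideal_exp k (a * x).
Proof.
case: k => [|k] //= [s Hs ->]; exists [seq (a * p.1, p.2) | p <- s].
  by move=> _ /mapP [p /Hs [pm pk] ->]; split=> //; exact: idealMr.
by rewrite big_map mulr_sumr; apply: eq_bigr => p _; rewrite mulrA.
Qed.

Lemma ideal_expN k x : ideal_exp k x -> ideal_exp k (- x).
Proof. by rewrite -mulN1r; exact: ideal_expM. Qed.

Lemma ideal_expS k x : ideal_exp k.+1 x -> ideal_exp k x.
Proof.
move=> /= [s]; elim: s x => [|p s IH] x Hs ->.
  by rewrite big_nil; exact: ideal_exp0.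
rewrite big_cons; apply: ideal_expD.
  by apply: ideal_expM; have [] := Hs p (mem_head _ _).
by apply: IH => // q qs; apply: Hs; rewrite in_cons qs orbT.
Qed.

Lemma ideal_exp_le k l x : (k <= l)%N -> ideal_exp l x -> ideal_exp k x.
Proof.
by move=> /subnK <-; elim: (l - k)%N => // d IH; rewrite addSn => /ideal_expS.
Qed.

(* A copy of R carrying the m-adic uniform structure, whose basic entourages
   are { (x, y) | x - y \in m ^ k }; matrices over it then get the product
   uniformity, i.e. the m-adic one. *)
Definition adic (I : idealr R) : Type := R.

HB.instance Definition _ := GRing.IntegralDomain.on (adic m).
HB.instance Definition _ := isPointed.Build (adic m) (0 : R).

Definition adic_entourage : set_system (adic m * adic m) :=
  filter_from [set: nat] (fun k => [set p | ideal_exp k ((p.1 : R) - p.2)]).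

Local Lemma adic_ent_filter : Filter adic_entourage.
Proof.
apply: filter_from_filter; first by exists 0%N.
move=> i j _ _; exists (maxn i j) => // p /= Hp.
by split; apply: ideal_exp_le Hp; rewrite (leq_maxl, leq_maxr).
Qed.

Local Lemma adic_ent_refl A : adic_entourage A -> diagonal `<=` A.
Proof.
move=> [k _ kA] [x y] /diagonalP <-; apply: kA => /=.
by rewrite subrr; exact: ideal_exp0.
Qed.

Local Lemma adic_ent_inv A :
  adic_entourage A -> adic_entourage (A^-1)%relation.
Proof.
move=> [k _ kA]; exists k => // -[x y] /= Hxy; apply: kA => /=.
by rewrite -opprB; exact: ideal_expN.
Qed.

Local Lemma adic_ent_split A : adic_entourage A ->
  exists2 B, adic_entourage B & (B \; B `<=` A)%relation.
Proof.
move=> [k _ kA]; exists [set p | ideal_exp k ((p.1 : R) - p.2)]; first by exists k.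
move=> [x y] /= [z /= xz zy]; apply: kA => /=.
by rewrite -(subrKA z); exact: ideal_expD.
Qed.

HB.instance Definition _ := isUniform.Build (adic m)
  adic_ent_filter adic_ent_refl adic_ent_inv adic_ent_split.

Definition adically_complete : Prop :=
  forall F : set_system (adic m), ProperFilter F -> cauchy F -> cvg F.

Definition borel_mx (n : nat) :=
  g_sigma_algebraType (@open 'M[adic m]_n).

(* Normalized Haar measure on the additive group of matrices: total mass 1 is
   part of [probability]; translation on one side is enough, the group being
   commutative.  Regularity is automatic when the group is compact, the m-adic
   topology being metrizable. *)
Definition haar_probability (K : realType) (n : nat)
    (mu : probability (borel_mx n) K) : Prop :=
  forall (A : 'M[R]_n) (X : set (borel_mx n)), measurable X ->
    mu [set (A + Y : 'M[R]_n) | Y in X] = mu X.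

End AdicTopology.

Section Cokernel.
Context {R : comNzRingType} {n : nat} (B : 'M[R]_n).

Definition mximage : {pred 'cV[R]_n} :=
  fun v => `[< exists u : 'cV[R]_n, v = B *m u >].

Local Lemma mximage_zmod : zmod_closed mximage.
Proof.
split; first by apply/asboolP; exists 0; rewrite mulmx0.
move=> _ _ /asboolP [u ->] /asboolP [v ->]; apply/asboolP.
by exists (u - v); rewrite mulmxBr.
Qed.

HB.instance Definition _ := GRing.isZmodClosed.Build _ mximage mximage_zmod.

Definition coker : Type := Quotient.quot (GRing.ZmodClosed.clone _ mximage _).

HB.instance Definition _ := @ZmodQuotient.on coker.

Definition coker_scale (a : R) (x : coker) : coker := \pi_coker (a *: repr x).

Local Lemma pi_coker_scale a v :
  coker_scale a (\pi_coker v) = \pi_coker (a *: v).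
Proof.
apply/eqP; rewrite /coker_scale -Quotient.idealrBE -scalerBr.
have : repr (\pi_coker v) - v \in mximage.
  by rewrite Quotient.idealrBE reprK.
by move=> /asboolP [u ->]; apply/asboolP; exists (a *: u); rewrite scalemxAr.
Qed.

Local Lemma coker_scaleA a b x :
  coker_scale a (coker_scale b x) = coker_scale (a * b) x.
Proof.
rewrite -[x]reprK; set v := repr x.
by rewrite (pi_coker_scale b v) (pi_coker_scale a) pi_coker_scale scalerA.
Qed.

Local Lemma coker_scale1 : left_id 1 coker_scale.
Proof. by move=> x; rewrite -[x]reprK pi_coker_scale scale1r. Qed.

Local Lemma coker_scaleDr : right_distributive coker_scale +%R.
Proof.
move=> a x y; rewrite -[x]reprK -[y]reprK; set v := repr x; set w := repr y.
rewrite -raddfD (pi_coker_scale a v) (pi_coker_scale a w) pi_coker_scale.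
by rewrite scalerDr raddfD.
Qed.

Local Lemma coker_scaleDl x : {morph coker_scale^~ x : a b / a + b}.
Proof.
move=> a b; rewrite -[x]reprK; set v := repr x => /=.
rewrite (pi_coker_scale a v) (pi_coker_scale b v) (pi_coker_scale (a + b) v).
by rewrite scalerDl raddfD.
Qed.

HB.instance Definition _ := GRing.Zmodule_isLmodule.Build R coker
  coker_scaleA coker_scale1 coker_scaleDr coker_scaleDl.

End Cokernel.

(* \prod_(1 <= i) u i, starting at i = 1; [limn] is meaningful in particular
   when all u i lie in [0, 1], the partial products being then nonincreasing. *)
Definition infinite_product (K : realType) (u : nat -> K) : K :=
  limn (fun N => \prod_(1 <= i < N.+1) u i).

(* The reduction of p modulo m, R/m being identified with F along phi. *)
Definition reduction (R : idomainType) (m : idealr R) (F : fieldType)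
    (phi : {rmorphism {ideal_quot m} -> F}) (p : {poly R}) : {poly F} :=
  map_poly (phi \o \pi_{ideal_quot m}) p.

(* Main.v *)
(* Since R is local, coker(P_j(A)) = 0 depends only on A modulo m, and the Haar
   measure induces the uniform measure on matrices over F, with q = #|F|.
   For a uniform A over F, let X_j be the number of intertwiners from a companion
   matrix of P_j to A, that is the cardinality of the kernel of P_j(A); it is a
   power of Q_j = q ^ deg P_j and equals 1 iff P_j(A) is invertible.  For each
   family e, the product over j and i < e_j of the X_j - Q_j ^ i counts the
   embeddings of the sum over j of (F[t]/P_j)^(e_j) into F^n equipped with A;
   linear algebra gives its mean exactly, namely
   prod_(i < D) (1 - q ^ (i - n)) with D = sum_j e_j deg P_j, which is close to 1.
   Expanding the indicator of X_j = 1 in the Newton basis prod_(i < e) (X - Q_j ^ i)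
   has summable coefficients c_j(e), so the probability is within O(q ^ - n) of
   prod_j sum_e c_j(e), which Euler's identity evaluates as
   prod_j prod_(i >= 1) (1 - Q_j ^ - i). *)
From HB Require Import structures.
Require Import Defs.
From mathcomp Require Import all_boot all_order all_algebra.
From mathcomp Require Import all_classical all_reals all_analysis.
From mathcomp Require Import ring lra zify.

Set Implicit Arguments.
Unset Strict Implicit.
Unset Printing Implicit Defensive.

Import Order.TTheory GRing.Theory Num.Theory.
Import numFieldNormedType.Exports.

Local Open Scope ring_scope.

(** * Intertwiners and embeddings between matrices *)

Section Intertwiners.
Variable F : finFieldType.

(** Vectors are rows, so these are the [F[t]]-linear maps from [F^m], with t acting by [C], to
    [F^n], with t acting by [A]. *)
Definition intertwiners m n (C : 'M[F]_m) (A : 'M[F]_n) : {set 'M[F]_(m, n)} :=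
  [set W | W *m A == C *m W].

Definition embeddings m n (C : 'M[F]_m) (A : 'M[F]_n) : {set 'M[F]_(m, n)} :=
  [set W in intertwiners C A | row_free W].

Definition simple_mx m (C : 'M[F]_m) : Prop :=
  forall U : 'M[F]_m, stablemx U C -> U = 0 \/ row_full U.

Lemma intertwinersP m n (C : 'M[F]_m) (A : 'M[F]_n) W :
  reflect (W *m A = C *m W) (W \in intertwiners C A).
Proof. by rewrite inE; exact: eqP. Qed.

Lemma col_mx_intertwiners m1 m2 n (C1 : 'M[F]_m1) (C2 : 'M[F]_m2) (A : 'M[F]_n)
    K W : (col_mx K W \in intertwiners (block_mx C1 0 0 C2) A) =
  (K \in intertwiners C1 A) && (W \in intertwiners C2 A).
Proof.
rewrite !inE mul_col_mx mul_block_col !mul0mx addr0 add0r.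
apply/eqP/andP => [/eq_col_mx [-> ->] | [/eqP -> /eqP ->]] //.
Qed.

Lemma card_intertwiners_block m n1 n2 (C : 'M[F]_m) (C1 : 'M[F]_n1)
    (C2 : 'M[F]_n2) :
  #|intertwiners C (block_mx C1 0 0 C2)| =
  (#|intertwiners C C1| * #|intertwiners C C2|)%N.
Proof.
rewrite -cardsX.
have inj : injective (fun X : 'M[F]_(m, n1 + n2) => (lsubmx X, rsubmx X)).
  by move=> X Y [EL ER]; rewrite -[X]hsubmxK EL ER hsubmxK.
rewrite -(card_imset _ inj); apply: eq_card => -[K W]; rewrite finset.in_setX /=.
have E : (row_mx K W \in intertwiners C (block_mx C1 0 0 C2)) =
    (K \in intertwiners C C1) && (W \in intertwiners C C2).
  rewrite !inE mul_row_block mul_mx_row !mulmx0 addr0 add0r.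
  by apply/eqP/andP => [/eq_row_mx [-> ->] | [/eqP -> /eqP ->]].
rewrite -E; apply/imsetP/idP => [[X XC [-> ->]] | XC].
  by rewrite hsubmxK.
by exists (row_mx K W); rewrite ?row_mxKl ?row_mxKr.
Qed.

(* The vectors u such that u *m K lies in the row space of W form a C1-stable
   subspace, which is trivial or full as C1 is simple. *)
Lemma row_free_col_mx_simple m1 m2 n (C1 : 'M[F]_m1) (C2 : 'M[F]_m2)
    (A : 'M[F]_n) K W :
  simple_mx C1 -> (0 < m1)%N -> K \in intertwiners C1 A ->
  W \in intertwiners C2 A ->
  row_free (col_mx K W) = row_free W && ~~ (K <= W)%MS.
Proof.
move=> simC m1_gt0 /intertwinersP KA /intertwinersP WA.
apply/idP/andP => [freeKW | [freeW]]; last first.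
  pose U := kermx (K *m cokermx W).
  have UE k (u : 'M[F]_(k, m1)) : (u <= U)%MS = (u *m K <= W)%MS.
    by rewrite [RHS]submxE -mulmxA; apply/sub_kermxP/eqP.
  have stabU : stablemx U C1.
    rewrite UE -mulmxA -KA mulmxA.
    have /submxP [D ->] : (U *m K <= W)%MS by rewrite -UE.
    by rewrite -mulmxA WA mulmxA submxMl.
  have [U0 _ | ] := simC U stabU; last by rewrite -sub1mx UE mul1mx => ->.
  apply: inj_row_free => v; rewrite -[v]hsubmxK mul_row_col => /eqP.
  rewrite addr_eq0 => /eqP vE.
  have : (lsubmx v <= U)%MS by rewrite UE vE -mulNmx submxMl.
  rewrite U0 submx0 => /eqP v0; move: vE; rewrite v0 mul0mx => /esym/eqP.
  by rewrite oppr_eq0 mulmx_free_eq0 // => /eqP ->; rewrite row_mx0.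
split.
  apply: inj_row_free => v vW.
  have : row_mx 0 v *m col_mx K W = 0 by rewrite mul_row_col mul0mx add0r.
  by move/eqP; rewrite mulmx_free_eq0 // -row_mx0 => /eqP /eq_row_mx [].
apply/negP => /submxP [D KD].
have : row_mx 1%:M (- D) *m col_mx K W = 0.
  by rewrite mul_row_col mul1mx mulNmx -KD subrr.
move/eqP; rewrite mulmx_free_eq0 // -row_mx0 => /eqP /eq_row_mx [] /matrixP E _.
have := E (Ordinal m1_gt0) (Ordinal m1_gt0).
by rewrite !mxE eqxx => /eqP; rewrite oner_eq0.
Qed.

(** As [W] is row-free, each such [K] factors uniquely as [L *m W], and cancelling [W] shows that
    [L] intertwines [C1] and [C2]. *)
Lemma card_intertwiners_sub m1 m2 n (C1 : 'M[F]_m1) (C2 : 'M[F]_m2)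
    (A : 'M[F]_n) W : W \in embeddings C2 A ->
  #|[set K in intertwiners C1 A | (K <= W)%MS]| = #|intertwiners C1 C2|.
Proof.
rewrite inE => /andP [/intertwinersP WA freeW].
rewrite -(card_imset _ (row_free_inj freeW (m := m1))); apply: eq_card => K.
apply/setIdP/imsetP => [[/intertwinersP KA /submxP [L KL]] | [L /intertwinersP LA ->]].
  exists L => //; apply/intertwinersP/(row_free_inj freeW) => /=.
  by rewrite -mulmxA -WA -[RHS]mulmxA -KL -KA KL mulmxA.
split; last exact: submxMl.
by apply/intertwinersP; rewrite -mulmxA WA !mulmxA LA.
Qed.

(** By simplicity of [C1], an embedding of the sum is an embedding [W] of [C2] plus any intertwiner
    [K] from [C1] not contained in [W]. The excluded [K] are counted by [card_intertwiners_sub];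
    they stand on the left to avoid truncated subtraction. *)
Lemma card_embeddings_block m1 m2 n (C1 : 'M[F]_m1) (C2 : 'M[F]_m2)
    (A : 'M[F]_n) : simple_mx C1 -> (0 < m1)%N ->
  (#|embeddings (block_mx C1 0 0 C2) A| + #|embeddings C2 A| * #|intertwiners C1 C2|
   = #|embeddings C2 A| * #|intertwiners C1 A|)%N.
Proof.
move=> simC m1_gt0.
have -> : #|embeddings (block_mx C1 0 0 C2) A| =
    (\sum_(W in embeddings C2 A)
      #|[set K in intertwiners C1 A | ~~ (K <= W)%MS]|)%N.
  rewrite -sum1_card (partition_big dsubmx (mem (embeddings C2 A))) /=.
    apply: eq_bigr => W WC; rewrite -sum1_card (reindex (col_mx^~ W)) /=; last first.
      exists usubmx => [v _ | vA]; first by rewrite col_mxKu.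
      by case/andP=> _ /eqP <-; rewrite vsubmxK.
    move: WC; rewrite inE => /andP [WC freeW].
    apply: eq_bigl => K; rewrite inE col_mx_intertwiners col_mxKd eqxx andbT WC andbT.
    rewrite [RHS]finset.in_set; apply: andb_id2l => KC.
    by rewrite (row_free_col_mx_simple simC _ KC WC) ?freeW.
  move=> X; rewrite inE -{1 2}[X]vsubmxK col_mx_intertwiners.
  case/andP=> /andP [KC WC]; rewrite (row_free_col_mx_simple simC _ KC WC) //.
  by case/andP => freeW _; rewrite finset.in_set WC.
rewrite -!sum_nat_const -big_split /=; apply: eq_bigr => W WC.
rewrite -(card_intertwiners_sub C1 WC) addnC.
rewrite -(cardsID [set K | (K <= W)%MS] (intertwiners C1 A)); congr (_ + _)%N.
  by apply: eq_card => K; rewrite !inE.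
by apply: eq_card => K; rewrite !inE andbC.
Qed.
End Intertwiners.

(** * Krylov matrices, cyclic vectors and intertwiners from an irreducible block *)

Section Krylov.
Variable F : fieldType.

Definition krylov m n (A : 'M[F]_n.+1) (v : 'rV[F]_n.+1) : 'M[F]_(m, n.+1) :=
  \matrix_(i < m) (v *m A ^+ i).

Lemma mul_krylov m n (A : 'M[F]_n.+1) (v : 'rV[F]_n.+1) (w : 'rV[F]_m) :
  w *m krylov m A v = v *m horner_mx A (rVpoly w).
Proof.
rewrite mulmx_sum_row [rVpoly w]poly_def linear_sum mulmx_sumr.
apply: eq_bigr => i _; rewrite rowK valK /= linearZ /= rmorphXn /= horner_mx_X.
by rewrite -scalemxAr.
Qed.

Lemma coprime_char_poly_unitmx n (A : 'M[F]_n.+1) p :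
  coprimep (char_poly A) p -> horner_mx A p \in unitmx.
Proof.
move=> /Bezout_eq1_coprimepP [[u v] /= uv1].
have : horner_mx A (u * char_poly A + v * p) = 1%:M by rewrite uv1 rmorph1.
rewrite rmorphD !rmorphM /= Cayley_Hamilton mulr0 add0r => vp1.
by have /mulmx1_unit [] := vp1.
Qed.

Lemma size_mod_char_poly n (A : 'M[F]_n.+1) (p : {poly F}) :
  (size (p %% char_poly A)%R <= n.+1)%N.
Proof.
by rewrite -ltnS -(size_char_poly A) ltn_modp -size_poly_gt0 size_char_poly.
Qed.

Lemma horner_mx_mod n (A : 'M[F]_n.+1) d (C : 'M[F]_d.+1) (p : {poly F})
    (v : 'rV[F]_n.+1) :
  v *m horner_mx A (char_poly C) = 0 ->
  v *m horner_mx A p = v *m horner_mx A (p %% char_poly C).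
Proof.
move=> v0; rewrite {1}(divp_eq p (char_poly C)) rmorphD /= mulmxDr mulrC.
by rewrite rmorphM /= mulmxA v0 mul0mx add0r.
Qed.

Lemma horner_mx_intertwiner m n (A : 'M[F]_n.+1) (C : 'M[F]_m.+1) K p :
  K *m A = C *m K -> K *m horner_mx A p = horner_mx C p *m K.
Proof.
move=> KA; elim/poly_ind: p => [|p c IHp]; first by rewrite !rmorph0 mulmx0 mul0mx.
rewrite !rmorphD !rmorphM /= !horner_mx_X !horner_mx_C mulmxDr mulmxDl.
by rewrite mulmxA IHp -mulmxA KA mulmxA scalar_mxC.
Qed.

Section Irreducible.
Variables (d : nat) (C : 'M[F]_d.+1).
Hypothesis irrC : irreducible_poly (char_poly C).

(** A relation among the rows is a nonzero polynomial of degree at most [d] killing [u]. It is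
    coprime to [char_poly C], so its value at [C] is invertible, which forces [u] to vanish. *)
Lemma krylov_unitmx (u : 'rV[F]_d.+1) : u != 0 -> krylov d.+1 C u \in unitmx.
Proof.
move=> u_neq0; rewrite -row_free_unit; apply: inj_row_free => w.
rewrite mul_krylov => uw0; apply/eqP/negPn/negP => w_neq0.
have rw_neq0 : rVpoly w != 0.
  by apply: contra w_neq0 => /eqP rw0; rewrite -[w]rVpolyK rw0 linear0.
have : coprimep (char_poly C) (rVpoly w).
  rewrite irreducible_poly_coprime //; apply/negP => /(dvdp_leq rw_neq0).
  by rewrite size_char_poly leqNgt ltnS size_poly.
move/coprime_char_poly_unitmx => unitw; move: u_neq0.
by rewrite -[u](mulmxK unitw) uw0 mul0mx eqxx.
Qed.

End Irreducible.
End Krylov.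

Section IrreducibleIntertwiners.
Variables (F : finFieldType) (d : nat) (C : 'M[F]_d.+1).
Hypothesis irrC : irreducible_poly (char_poly C).

Lemma simple_mx_irreducible : simple_mx C.
Proof.
move=> U stabU; have [->|U_neq0] := eqVneq U 0; [by left | right].
have /rowV0Pn [u uU u_neq0] := U_neq0.
rewrite -sub1mx -(mulVmx (krylov_unitmx irrC u_neq0)).
apply: mulmx_sub; apply/row_subP => i; rewrite rowK.
have := horner_mx_stable ('X^i) stabU; rewrite rmorphXn /= horner_mx_X.
exact: submx_trans (submxMr _ uU).
Qed.

(** The first basis vector [u] is cyclic for [C], so an intertwiner [K] is determined by [u *m K], a
    vector killed by [char_poly C] evaluated at [A]. *)
Lemma card_intertwiners_ker n (A : 'M[F]_n.+1) :
  #|intertwiners C A| = #|[set v : 'rV[F]_n.+1 | v *m horner_mx A (char_poly C) == 0]|.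
Proof.
pose u : 'rV[F]_d.+1 := delta_mx 0 ord0.
have u_neq0 : u != 0.
  by apply/eqP => /rowP /(_ ord0); rewrite !mxE !eqxx => /eqP; rewrite oner_eq0.
have unitu := krylov_unitmx irrC u_neq0.
have inju : {in intertwiners C A &, injective (mulmx u)}.
  suff krylovu K : K \in intertwiners C A ->
      krylov d.+1 C u *m K = krylov d.+1 A (u *m K).
    move=> K L KC LC uKL; apply: (can_inj (mulKmx unitu)).
    by rewrite !krylovu // uKL.
  move/intertwinersP => KC; apply/row_matrixP => i; rewrite row_mul !rowK.
  have := horner_mx_intertwiner ('X^i) KC; rewrite !rmorphXn /= !horner_mx_X.
  by rewrite -!mulmxA => ->.
rewrite -(card_in_imset inju); apply: eq_card => v; rewrite [RHS]inE.
apply/imsetP/eqP => [[K /intertwinersP KC ->] | v0].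
  by rewrite -mulmxA (horner_mx_intertwiner _ KC) Cayley_Hamilton mul0mx mulmx0.
(* u is cyclic for C, so K can be prescribed by u *m K = v. *)
pose K := invmx (krylov d.+1 C u) *m krylov d.+1 A v.
(* Both sides depend only on [p] modulo [char_poly C], by Cayley-Hamilton for [C] and by [v0] for
   [A]; the remainder has at most [d.+1] coefficients, which the Krylov matrices evaluate. *)
have uK p : u *m horner_mx C p *m K = v *m horner_mx A p.
  rewrite (@horner_mx_mod _ _ C _ C) ?Cayley_Hamilton ?mulmx0 //.
  rewrite (@horner_mx_mod _ _ A _ C) //.
  rewrite -(poly_rV_K (size_mod_char_poly C p)) -!mul_krylov.
  by rewrite mulmxA mulmxK.
exists K; last by have := uK 1; rewrite !rmorph1 -!idmxE !mulmx1.
have uKX k : u *m C ^+ k *m K = v *m A ^+ k.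
  by have := uK ('X^k); rewrite !rmorphXn /= !horner_mx_X.
apply/intertwinersP/(can_inj (mulKmx unitu)); apply/row_matrixP => i.
rewrite !row_mul !rowK mulmxA uKX [RHS]mulmxA -[_ *m C]mulmxA -[v *m _ *m _]mulmxA.
by rewrite !mulmxE -!exprSr uKX.
Qed.

Lemma card_intertwiners_self : #|intertwiners C C| = (#|F| ^ d.+1)%N.
Proof.
rewrite card_intertwiners_ker Cayley_Hamilton -[X in (_ ^ X)%N]mul1n -card_mx.
by apply: eq_card => v; rewrite !inE mulmx0 eqxx.
Qed.

Lemma card_intertwiners_eq1 n (A : 'M[F]_n.+1) :
  (#|intertwiners C A| == 1%N) = (horner_mx A (char_poly C) \in unitmx).
Proof.
rewrite card_intertwiners_ker -row_free_unit -kermx_eq0 (cardD1 0) inE mul0mx eqxx.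
rewrite add1n eqSS; apply/pred0P/eqP => [ker0 | ker0 v].
  apply/eqP/rowV0P => v /sub_kermxP v0; apply/eqP; have := ker0 v.
  by rewrite !inE v0 eqxx andbT => /negbFE.
rewrite /= !inE; apply/negbTE; rewrite negb_and negbK orbC -implyNb negbK.
by apply/implyP => /eqP /sub_kermxP; rewrite ker0 submx0.
Qed.
End IrreducibleIntertwiners.

(** * Mean number of embeddings, and embeddings of sums of irreducible blocks *)

Section CountEmbeddings.
Variable F : finFieldType.
Local Notation q := #|F|.

Lemma simple_mx_1 (C : 'M[F]_1) : simple_mx C.
Proof.
move=> U _; have [->|U_neq0] := eqVneq U 0; [by left | right].
by rewrite /row_full eqn_leq rank_leq_row lt0n mxrank_eq0.
Qed.

(** A right inverse [V] of [W] translates any fibre of the map sending [A] to [W *m A] onto any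
    other, so all fibres have the same size. *)
Lemma card_fibre_mulmx m n p (W : 'M[F]_(m, n)) (B : 'M[F]_(m, p)) :
  row_free W -> (#|[set A : 'M[F]_(n, p) | W *m A == B]| * q ^ (m * p) = q ^ (n * p))%N.
Proof.
move=> /row_freeP [V WV]; rewrite -[in RHS]card_mx -[in LHS]card_mx mulnC.
rewrite -[RHS]sum1_card (partition_big (mulmx W) predT) //= -sum_nat_const.
apply: eq_bigr => B' _; rewrite sum1_card.
have inj : injective (fun A : 'M[F]_(n, p) => A + V *m (B' - B)) by exact: addIr.
rewrite -[LHS](card_imset _ inj); apply: eq_card => A.
rewrite -[RHS]/(W *m A == B'); apply/imsetP/eqP => [[A' + ->] | WA].
  by rewrite inE => /eqP WA'; rewrite mulmxDr WA' mulmxA WV mul1mx addrC subrK.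
exists (A - V *m (B' - B)); last by rewrite subrK.
by rewrite inE mulmxBr mulmxA WV mul1mx WA subKr.
Qed.

Variable K : numFieldType.

(* Full-rank matrices are the embeddings between zero matrices. *)
Lemma card_row_free m n :
  #|[set W : 'M[F]_(m, n) | row_free W]|%:R =
  \prod_(i < m) (q%:R ^+ n - q%:R ^+ i) :> K.
Proof.
have inter0 k l : intertwiners (0 : 'M[F]_k) (0 : 'M[F]_l) = [set: _].
  by apply/setP => W; rewrite !inE mul0mx mulmx0 eqxx.
have emb0 k l : embeddings (0 : 'M[F]_k) (0 : 'M[F]_l) = [set W | row_free W].
  by apply/setP => W; rewrite !inE mul0mx mulmx0 eqxx.
elim: m => [|m IHm].
  rewrite big_ord0 (_ : [set _ | _] = [set: _]) ?cardsT ?card_mx ?mul0n //.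
  by apply/setP => W; rewrite !inE /row_free flatmx0 mxrank0.
have := card_embeddings_block (0 : 'M[F]_m) (0 : 'M[F]_n) (@simple_mx_1 0) isT.
rewrite -[block_mx _ _ _ _]/(block_mx 0 0 0 0) block_mx0 !emb0 !inter0.
rewrite !cardsT !card_mx !mul1n => /(congr1 (fun k => k%:R : K)).
rewrite natrD !natrM !natrX IHm big_ord_recr /= mulrBr => <-.
by rewrite addrK.
Qed.

(** Double counting of the pairs [(A, W)]: for a fixed row-free [W] the admissible [A] form a fibre
    as in [card_fibre_mulmx], whose size does not depend on [C]. *)
Lemma sum_card_embeddings m n (C : 'M[F]_m) :
  (\sum_(A : 'M[F]_n) #|embeddings C A|)%:R / q%:R ^+ (n * n) =
  \prod_(i < m) (1 - q%:R ^+ i / q%:R ^+ n) :> K.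
Proof.
have q_neq0 : (q%:R : K) != 0.
  by rewrite pnatr_eq0 -lt0n; apply/card_gt0P; exists 0.
have -> : \prod_(i < m) (1 - q%:R ^+ i / q%:R ^+ n) =
    #|[set W : 'M[F]_(m, n) | row_free W]|%:R / q%:R ^+ (m * n) :> K.
  have -> : q%:R ^+ (m * n) = \prod_(i < m) q%:R ^+ n :> K.
    by rewrite prodr_const card_ord -exprM mulnC.
  rewrite card_row_free -prodf_div; apply: eq_bigr => i _.
  by rewrite mulrBl divff ?expf_neq0.
apply/eqP; rewrite eqr_div ?expf_neq0 // -!natrX -!natrM; apply/eqP; congr (_%:R).
transitivity ((\sum_(W : 'M[F]_(m, n) | row_free W)
    #|[set A : 'M[F]_n | W *m A == C *m W]|) * q ^ (m * n))%N.
  congr (_ * _)%N; under eq_bigr => A _ do rewrite -sum1_card big_mkcond /=.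
  rewrite exchange_big /= [RHS]big_mkcond /=; apply: eq_bigr => W _.
  case: ifPn => Wfree; last by rewrite big1 // => A _; rewrite inE (negbTE Wfree) andbF.
  rewrite -sum1_card [RHS]big_mkcond; apply: eq_bigr => A _.
  by rewrite !inE Wfree andbT.
rewrite big_distrl /= -sum_nat_const; apply: eq_big => [W|W Wfree].
  by rewrite inE.
by rewrite card_fibre_mulmx.
Qed.

Variables (I : finType) (d : I -> nat) (C : forall j, 'M[F]_((d j).+1)).
Hypothesis irrC : forall j, irreducible_poly (char_poly (C j)).
Hypothesis injC : injective (fun j => char_poly (C j)).

Fixpoint blocks_dim (s : seq I) : nat :=
  if s is j :: s' then ((d j).+1 + blocks_dim s')%N else 0.

Fixpoint blocks_mx (s : seq I) : 'M[F]_(blocks_dim s) :=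
  if s is j :: s' then block_mx (C j) 0 0 (blocks_mx s') else 0.

Lemma blocks_dimE s : blocks_dim s = (\sum_j (d j).+1 * count_mem j s)%N.
Proof.
elim: s => [|j s IHs] /=; first by rewrite big1 // => j _; rewrite muln0.
rewrite IHs [RHS](bigD1 j) //= [in LHS](bigD1 j) //= eqxx mulnDr muln1 addnA.
congr (_ + _)%N; apply: eq_bigr => i; rewrite eq_sym => /negbTE ->.
by rewrite add0n.
Qed.

(** Schur's lemma: distinct characteristic polynomials are coprime, which leaves only the zero
    map. *)
Lemma card_intertwiners_irreducible i j :
  #|intertwiners (C i) (C j)| = (q ^ ((d i).+1 * (i == j)))%N.
Proof.
have [<-|neq_ij] := eqVneq; first by rewrite muln1 card_intertwiners_self.
rewrite muln0; apply/eqP; rewrite card_intertwiners_eq1 //.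
apply: coprime_char_poly_unitmx; rewrite irreducible_poly_coprime //.
have [_ irri] := irrC i; apply/negP => /irri.
have /[swap] /[apply] : size (char_poly (C j)) != 1%N by rewrite size_char_poly.
rewrite eqp_monic ?char_poly_monic // => /eqP /injC ji.
by rewrite ji eqxx in neq_ij.
Qed.

Lemma card_intertwiners_blocks j s :
  #|intertwiners (C j) (blocks_mx s)| = (q ^ ((d j).+1 * count_mem j s))%N.
Proof.
elim: s => [|i s IHs] /=.
  rewrite (_ : intertwiners _ _ = [set: _]) ?cardsT ?card_mx //.
  by apply/setP => W; rewrite !inE; apply/eqP/matrixP => k [].
rewrite card_intertwiners_block IHs card_intertwiners_irreducible mulnDr expnD.
by rewrite eq_sym.
Qed.

(** One more block [j] multiplies the count by the number of intertwiners from [C j] into [A] minus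
    the number into the blocks already present. *)
Lemma card_embeddings_blocks n (A : 'M[F]_n) s :
  #|embeddings (blocks_mx s) A|%:R =
  \prod_j \prod_(i < count_mem j s)
    (#|intertwiners (C j) A|%:R - q%:R ^+ ((d j).+1 * i)) :> K.
Proof.
elim: s => [|j s IHs].
  rewrite big1 => [|j _]; last by rewrite big_ord0.
  rewrite (_ : embeddings _ _ = [set: _]) ?cardsT ?card_mx ?mul0n //.
  apply/setP => W; rewrite !inE /row_free eqn_leq rank_leq_row !andbT.
  by apply/eqP/matrixP; case.
have := card_embeddings_block (blocks_mx s) A (simple_mx_irreducible (irrC j)) isT.
move/(congr1 (fun k => k%:R : K)); rewrite natrD !natrM card_intertwiners_blocks.
move/eqP; rewrite natrX eq_sym -subr_eq eq_sym -mulrBr => /eqP /= ->.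
rewrite IHs (bigD1 j) //= [RHS](bigD1 j) //= eqxx big_ord_recr /= mulrAC; congr (_ * _).
by apply: eq_bigr => i; rewrite eq_sym => /negbTE ->; rewrite add0n.
Qed.
End CountEmbeddings.

(** * The q-series *)

Section EulerSeries.
Variable K : realFieldType.
Implicit Types (Q X y : K) (N n e : nat).

(* (-1) ^ e / \prod_(1 <= i <= e) (Q ^ i - 1), the sign being spread over the factors. *)
Definition euler_coef Q e : K := \prod_(i < e) (1 - Q ^+ i.+1)^-1.

Lemma euler_coefS Q e : euler_coef Q e.+1 = euler_coef Q e / (1 - Q ^+ e.+1).
Proof. by rewrite /euler_coef big_ord_recr. Qed.

(** Newton interpolation at the powers of [Q]: the truncation at [N] is the polynomial of degree [N]
    equal to 1 at 1 and to 0 at [Q], ..., [Q ^+ N]. *)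
Lemma sum_euler_newton Q X N : 1 < Q ->
  \sum_(e < N.+1) euler_coef Q e * \prod_(i < e) (X - Q ^+ i) =
  \prod_(i < N) ((X - Q ^+ i.+1) / (1 - Q ^+ i.+1)).
Proof.
move=> Q1; elim: N => [|N IHN].
  by rewrite big_ord1 /euler_coef !big_ord0 mulr1.
have Q0 : 1 - Q ^+ N.+1 != 0 by rewrite subr_eq0 lt_eqF // exprn_egt1.
rewrite big_ord_recr /= IHN [RHS]big_ord_recr /= prodf_div.
rewrite euler_coefS big_ord_recl expr0.
rewrite /euler_coef prodfV; set D := (\prod_(i < N) (1 - _))^-1.
under [in X in _ + X]eq_bigr => i _ do rewrite lift0.
set T := \prod_(i < N) (X - _); field.
by [].
Qed.

(** The vanishing product says that [X] is one of the nodes 1, [Q], ..., [Q ^+ N.-1]. *)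
Lemma euler_indicator Q X N : 1 < Q -> \prod_(i < N) (X - Q ^+ i) = 0 ->
  \sum_(e < N.+1) euler_coef Q e * \prod_(i < e) (X - Q ^+ i) = (X == 1)%:R.
Proof.
move=> Q1 /eqP/prodf_eq0 [[[|i] ltiN] _ /=]; rewrite subr_eq0 => /eqP ->.
  rewrite expr0 eqxx sum_euler_newton // big1 // => i _.
  by rewrite divff // subr_eq0 lt_eqF // exprn_egt1.
rewrite sum_euler_newton // gt_eqF ?exprn_egt1 //.
by rewrite (bigD1 (Ordinal (ltnW ltiN))) //= subrr mul0r mul0r.
Qed.

(** A functional equation between the values at [y] and at [y * Q], up to a boundary term; at
    [y = Q ^- n.+1] it drives the induction of [sum_euler_finite]. *)
Lemma sum_euler_shift Q y N : 1 < Q ->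
  \sum_(e < N.+1) euler_coef Q e * \prod_(i < e) (1 - y * Q ^+ i) =
  (1 - y) * (\sum_(e < N.+1) euler_coef Q e * \prod_(i < e) (1 - y * Q ^+ i.+1))
  + y * (euler_coef Q N * \prod_(i < N) (1 - y * Q ^+ i.+1)).
Proof.
move=> Q1; elim: N => [|N IHN].
  by rewrite !big_ord1 /euler_coef !big_ord0; ring.
have Q0 : 1 - Q ^+ N.+1 != 0 by rewrite subr_eq0 lt_eqF // exprn_egt1.
rewrite big_ord_recr /= IHN [in RHS]big_ord_recr /=.
rewrite !euler_coefS [\prod_(i < N.+1) (1 - y * Q ^+ i)]big_ord_recl expr0.
rewrite [\prod_(i < N.+1) (1 - y * Q ^+ i.+1)]big_ord_recr /=.
under [\prod_(i < N) (1 - y * Q ^+ (bump _ _))]eq_bigr => i _ do rewrite /bump add1n.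
set T := \prod_(i < N) _; set S := \sum_(i < _) _; field.
by [].
Qed.

Lemma sum_euler_finite Q n N : 1 < Q -> (n <= N)%N ->
  \sum_(e < N.+1) euler_coef Q e * \prod_(i < e) (1 - Q ^+ i / Q ^+ n) =
  \prod_(i < n) (1 - Q ^- i.+1).
Proof.
move=> Q1; have Q0 : Q != 0 by rewrite gt_eqF // (lt_trans ltr01).
elim: n => [|n IHn] leN.
  rewrite big_ord_recl !big_ord0 /euler_coef big_ord0 mulr1 big1 ?addr0 // => e _.
  by rewrite [X in _ * X]big_ord_recl expr0 divr1 subrr mul0r mulr0.
have shiftE i : Q ^- n.+1 * Q ^+ i.+1 = Q ^+ i / Q ^+ n.
  by rewrite !exprS; field; rewrite Q0 expf_neq0.
under eq_bigr do under eq_bigr do rewrite mulrC.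
rewrite sum_euler_shift //.
under eq_bigr do under eq_bigr do rewrite shiftE.
(* The boundary term contains the factor of index [n], which is zero; that index occurs because
   [n < N]. *)
rewrite IHn 1?ltnW // [X in _ * (_ * X)](bigD1 (Ordinal leN)) //= shiftE.
by rewrite divff ?expf_neq0 // subrr mul0r !mulr0 addr0 mulrC big_ord_recr.
Qed.

Lemma euler_coef_bound Q N : 2 <= Q ->
  \sum_(e < N) `|euler_coef Q e| * Q ^+ e <= 9.
Proof.
move=> Q2.
have pos e : 0 < Q ^+ e.+1 - 1 by rewrite subr_gt0 exprn_egt1 //; lra.
have step e : `|euler_coef Q e.+1| * Q ^+ e.+1 =
    `|euler_coef Q e| * Q ^+ e * (Q / (Q ^+ e.+1 - 1)).
  rewrite euler_coefS normrM normfV distrC (gtr0_norm (pos e)) [in X in _ * X = _]exprS.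
  by ring.
(* For [2 <= Q] the ratio leading to index [e] is at most 2 if [e = 1] and at most 2/3 from [e = 2]
   on. The geometric majorant sums to 9. *)
have bnd e : `|euler_coef Q e| * Q ^+ e <= 3 * (2 / 3) ^+ e.
  elim: e => [|[|e] IHe].
  - rewrite /euler_coef big_ord0 normr1 !expr0; lra.
  - rewrite step /euler_coef big_ord0 normr1 !expr0 expr1 mul1r mul1r.
    rewrite ler_pdivrMr; [nra | lra].
  - rewrite step [in leRHS]exprSr mulrA ler_pM //.
    + by rewrite mulr_ge0 // exprn_ge0 //; lra.
    + by rewrite divr_ge0 ?ltW ?pos //; lra.
    + rewrite ler_pdivrMr ?pos // !exprS.
      have : 1 <= Q ^+ e by rewrite exprn_ege1 //; lra.
      nra.
suff : \sum_(e < N) `|euler_coef Q e| * Q ^+ e <= 9 - 9 * (2 / 3) ^+ N.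
  have : 0 <= (2 / 3 : K) ^+ N by rewrite exprn_ge0 //; lra.
  lra.
elim: N => [|N IHN]; first by rewrite big_ord0 expr0; lra.
rewrite big_ord_recr /= exprSr.
by have := bnd N; lra.
Qed.

(** If [n < D] the factor of index [n] is zero and the bound is at least 1. Otherwise a further
    factor [1 - x] raises an error of at most [x] by at most [x], and [2 * x <= Q * x]. *)
Lemma gauss_product_bound Q n D : 2 <= Q ->
  `|1 - \prod_(i < D) (1 - Q ^+ i / Q ^+ n)| <= Q ^+ D / Q ^+ n.
Proof.
move=> Q2; have Qn k : 0 < Q ^+ k by rewrite exprn_gt0 //; lra.
case: (ltnP n D) => [ltnD | ].
  rewrite (bigD1 (Ordinal ltnD)) //= divff ?gt_eqF // subrr mul0r subr0 normr1.
  have Q1 : 1 <= Q by lra.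
  by rewrite ler_pdivlMr // mul1r; apply: ler_weXn2l => //; exact: ltnW.
set g := fun D => \prod_(i < D) (1 - Q ^+ i / Q ^+ n).
suff H : (D <= n)%N -> [/\ 0 <= g D, g D <= 1 & 1 - g D <= Q ^+ D / Q ^+ n].
  by move=> /H [g0 g1 gb]; rewrite ger0_norm // subr_ge0.
rewrite /g; elim: D => [_|D IHD ltDn].
  by rewrite big_ord0 subrr divr_ge0 // ltW.
have [g0 g1 gb] := IHD (ltnW ltDn).
rewrite big_ord_recr /= exprS -mulrA.
set x := Q ^+ D / Q ^+ n in gb *; set G := \prod_(i < D) _ in g0 g1 gb *.
have x0 : 0 <= x by rewrite divr_ge0 // ltW.
have x1 : x <= 1.
  have Q1 : 1 <= Q by lra.
  by rewrite ler_pdivrMr // mul1r; apply: ler_weXn2l => //; exact: ltnW.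
by split; nra.
Qed.

(** The sum in [sum_euler_finite] carries weights that differ from 1 by at most [Q ^+ e / Q ^+ n];
    [euler_coef_bound] adds up these errors. *)
Lemma sum_euler_bound Q n N : 2 <= Q -> (n <= N)%N ->
  `|\sum_(e < N.+1) euler_coef Q e - \prod_(i < n) (1 - Q ^- i.+1)| <= 9 / Q ^+ n.
Proof.
move=> Q2 leN; have Q1 : 1 < Q by lra.
rewrite -(sum_euler_finite Q1 leN) -sumrB.
have Qn0 : 0 < Q ^+ n by rewrite exprn_gt0 //; lra.
apply: le_trans (ler_norm_sum _ _ _) _.
apply: le_trans (ler_pM _ _ (euler_coef_bound N.+1 Q2) (lexx _)); last 2 first.
- by apply: sumr_ge0 => e _; rewrite mulr_ge0 // exprn_ge0 //; lra.
- by rewrite invr_ge0 ltW.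
rewrite big_distrl /=; apply: ler_sum => e _.
rewrite -[X in `|X - _|]mulr1 -mulrBr normrM -mulrA ler_wpM2l //.
exact: gauss_product_bound.
Qed.
End EulerSeries.

(** * Probability of simultaneous invertibility over a finite field *)

Section FiniteFieldProbability.
Variables (K : realFieldType) (F : finFieldType) (I : finType) (d : I -> nat).
Variable C : forall j, 'M[F]_((d j).+1).
Hypothesis irrC : forall j, irreducible_poly (char_poly (C j)).
Hypothesis injC : injective (fun j => char_poly (C j)).
Local Notation q := #|F|.
Local Notation Q j := (q%:R ^+ (d j).+1 : K).

Lemma card_finField_ge2 : 2 <= q%:R :> K.
Proof. by rewrite (ler_nat K 2); exact: card_finNzRing_gt1. Qed.

Lemma card_finField_exp_ge2 j : 2 <= Q j.
Proof.
apply: le_trans card_finField_ge2 _; rewrite -[leLHS]expr1; apply: ler_weXn2l => //.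
by have := card_finField_ge2; lra.
Qed.

Definition block_list N (e : {ffun I -> 'I_N}) : seq I :=
  flatten [seq nseq (e j) j | j <- enum I].

Lemma count_block_list N (e : {ffun I -> 'I_N}) j :
  count_mem j (block_list e) = e j.
Proof.
rewrite /block_list count_flatten -map_comp sumnE big_map big_enum /=.
rewrite (bigD1 j) //= count_nseq /= eqxx mul1n big1 ?addn0 // => i neq_ij.
by rewrite count_nseq /= (negbTE neq_ij).
Qed.

(* n.+1 copies of block j do not embed into dimension n. *)
Lemma card_intertwiners_root n (A : 'M[F]_n) j :
  \prod_(i < n.+1) (#|intertwiners (C j) A|%:R - Q j ^+ i) = 0 :> K.
Proof.
have [s cnt] : exists s, forall i, count_mem i s = ((j == i) * n.+1)%N.
  by exists (nseq n.+1 j) => i; rewrite count_nseq.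
have := card_embeddings_blocks K irrC injC A s.
rewrite [RHS](bigD1 j) //= [X in _ * X]big1 ?mulr1 => [|i neq_ij]; last first.
  by rewrite cnt eq_sym (negbTE neq_ij) big_ord0.
rewrite cnt eqxx mul1n => E.
rewrite (eq_bigr (fun i : 'I_n.+1 =>
  #|intertwiners (C j) A|%:R - q%:R ^+ ((d j).+1 * i))); last first.
  by move=> i _; rewrite exprM.
rewrite -E; apply/eqP; rewrite pnatr_eq0 cards_eq0 -finset.subset0; apply/fintype.subsetP => W.
rewrite inE /row_free => /andP [_ /eqP rkW].
exfalso; suff : ~~ (blocks_dim d s <= n)%N by rewrite -rkW rank_leq_col.
rewrite blocks_dimE (bigD1 j) //= cnt eqxx.
by rewrite mul1n; nia.
Qed.

(** By [card_intertwiners_root] the number of intertwiners is one of the first [n.+2] powers of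
    [Q j], so the Newton expansion stops at [e = n.+2]. Expanding the product over [j] turns the
    Newton products into embedding counts. *)
Lemma unit_indicator n (A : 'M[F]_n.+1) :
  ([forall j, horner_mx A (char_poly (C j)) \in unitmx])%:R =
  \sum_(e : {ffun I -> 'I_n.+3})
    (\prod_j euler_coef (Q j) (e j)) * #|embeddings (blocks_mx C (block_list e)) A|%:R
  :> K.
Proof.
transitivity (\prod_j (#|intertwiners (C j) A|%:R == 1 :> K)%:R : K).
  under eq_bigr do rewrite (eqr_nat K _ 1) card_intertwiners_eq1 //.
  case: (boolP [forall j, horner_mx A (char_poly (C j)) \in unitmx]) => [/forallP unitA|].
    by rewrite big1 // => j _; rewrite unitA.
  by rewrite negb_forall => /existsP [j /negbTE Aj]; rewrite (bigD1 j) //= Aj mul0r.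
under eq_bigr => j _.
  rewrite -(euler_indicator _ (card_intertwiners_root A j)); last first.
    by have := card_finField_exp_ge2 j; lra.
  over.
rewrite bigA_distr_bigA /=; apply: eq_bigr => e _.
rewrite big_split /= card_embeddings_blocks //; congr (_ * _).
apply: eq_bigr => j _; rewrite count_block_list.
by apply: eq_bigr => i _; rewrite exprM.
Qed.

(** Averaging [unit_indicator] is exact by [sum_card_embeddings]; the error comes only from
    replacing the Gaussian products by 1. Its bound factors over [j], each factor being at most
    9. *)
Lemma unit_probability_approx n :
  `|#|[set A : 'M[F]_n.+1 | [forall j, horner_mx A (char_poly (C j)) \in unitmx]]|%:R
      / q%:R ^+ (n.+1 * n.+1)
    - \prod_j \sum_(e < n.+3) euler_coef (Q j) e| <= 9 ^+ #|I| / q%:R ^+ n.+1 :> K.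
Proof.
have q2 := card_finField_ge2; have q0 : 0 < (q%:R : K) by lra.
have -> : #|[set A : 'M[F]_n.+1 | [forall j, horner_mx A (char_poly (C j)) \in unitmx]]|%:R
      / q%:R ^+ (n.+1 * n.+1) =
    \sum_(e : {ffun I -> 'I_n.+3}) (\prod_j euler_coef (Q j) (e j)) *
      \prod_(i < blocks_dim d (block_list e)) (1 - q%:R ^+ i / q%:R ^+ n.+1) :> K.
  rewrite -sum1_card big_mkcond natr_sum.
  under eq_bigr => A _ do
    rewrite inE -[if _ then _ else _]/(nat_of_bool _) unit_indicator.
  rewrite exchange_big big_distrl /=; apply: eq_bigr => e _.
  by rewrite -big_distrr /= -mulrA -natr_sum sum_card_embeddings.
rewrite bigA_distr_bigA -sumrB; apply: le_trans (ler_norm_sum _ _ _) _.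
have -> : 9 ^+ #|I| = \prod_(j : I) (9 : K) by rewrite prodr_const.
apply: (@le_trans _ _ ((\prod_j \sum_(e < n.+3) `|euler_coef (Q j) e| * Q j ^+ e)
    / q%:R ^+ n.+1)).
  rewrite bigA_distr_bigA big_distrl /=; apply: ler_sum => e _.
  rewrite -[X in `|_ - X|]mulr1 -mulrBr normrM distrC normr_prod big_split -!mulrA /=.
  rewrite ler_wpM2l ?prodr_ge0 //.
  rewrite (_ : \prod_j (Q j) ^+ e j = q%:R ^+ blocks_dim d (block_list e)).
    exact: gauss_product_bound.
  rewrite blocks_dimE expr_sum; apply: eq_bigr => j _.
  by rewrite count_block_list exprM.
apply: ler_wpM2r; first by rewrite invr_ge0 exprn_ge0 // ltW.
apply: ler_prod => j _; rewrite euler_coef_bound ?card_finField_exp_ge2 // andbT.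
by apply: sumr_ge0 => e _; rewrite mulr_ge0 // exprn_ge0.
Qed.
End FiniteFieldProbability.

Local Open Scope classical_set_scope.
Local Open Scope ring_scope.

(** * Passage to the limit and infinite products *)

Section Limit.
Variable K : realType.

Lemma cvg_geometric_close (Q M : K) (u v : nat -> K) (l : K) : 2 <= Q ->
  (forall n, `|u n - v n| <= M / Q ^+ n) -> v @ \oo --> l -> u @ \oo --> l.
Proof.
move=> Q2 uv vl; have -> : u = (fun n => (u n - v n) + v n).
  by apply/funext => n; rewrite subrK.
rewrite -[l]add0r; apply: cvgD => //; apply: norm_cvg0.
have geo0 : (fun n => M / Q ^+ n) @ \oo --> 0.
  rewrite (_ : (fun n => _) = geometric M Q^-1).
    apply: cvg_geometric; rewrite ger0_norm ?invr_ge0; last by lra.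
    by rewrite invf_lt1; lra.
  by apply/funext => n; rewrite /= exprVn.
apply: (squeeze_cvgr _ (cvg_cst 0) geo0).
by apply: nearW => n; rewrite normr_ge0 uv.
Qed.

Lemma cvg_infinite_product (Q : K) : 2 <= Q ->
  (fun n => \prod_(i < n) (1 - Q ^- i.+1)) @ \oo -->
  infinite_product (fun i => 1 - Q ^- i).
Proof.
move=> Q2; rewrite /infinite_product.
rewrite (_ : (fun n => _) = (fun N => \prod_(1 <= i < N.+1) (1 - Q ^- i))); last first.
  by apply/funext => n; rewrite big_add1 big_mkord.
have factor i : 0 <= 1 - Q ^- i <= 1.
  have Q0 : 0 < Q ^+ i by rewrite exprn_gt0 //; lra.
  rewrite subr_ge0 gerBl invr_ge0 (ltW Q0) andbT invf_le1 //.
  by rewrite exprn_ege1 //; lra.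
have pos n : 0 <= \prod_(1 <= i < n.+1) (1 - Q ^- i).
  by apply: prodr_ge0 => i _; have /andP [] := factor i.
(* The partial products decrease and stay nonnegative, so [limn] is a genuine limit here. *)
apply: nonincreasing_is_cvgn.
  apply/nonincreasing_seqP => n; rewrite big_nat_recr //=.
  by rewrite ler_piMr //; have /andP [] := factor n.+1.
by exists 0 => _ [n _ <-]; exact: pos.
Qed.

Lemma cvg_sum_euler (Q : K) : 2 <= Q ->
  (fun n => \sum_(e < n.+3) euler_coef Q e) @ \oo -->
  infinite_product (fun i => 1 - Q ^- i).
Proof.
move=> Q2; apply: (cvg_geometric_close Q2) (cvg_infinite_product Q2) => n.
by apply: sum_euler_bound => //; rewrite ltnW.
Qed.

Lemma cvg_unit_probability (F : finFieldType) (I : finType) (d : I -> nat)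
    (C : forall j, 'M[F]_((d j).+1)) :
  (forall j, irreducible_poly (char_poly (C j))) ->
  injective (fun j => char_poly (C j)) ->
  (fun n : nat =>
     #|[set A : 'M[F]_n.+1 |
        [forall j, horner_mx A (char_poly (C j)) \in unitmx]]%SET|%:R
     / #|F|%:R ^+ (n.+1 * n.+1) : K) @ \oo -->
  \prod_j infinite_product (fun i => 1 - (#|F|%:R : K) ^- (i * (d j).+1)).
Proof.
move=> irrC injC; have q2 := card_finField_ge2 K F.
apply: (cvg_geometric_close (M := 9 ^+ #|I|) q2) => [n|].
  apply: le_trans (unit_probability_approx K irrC injC n) _.
  apply: ler_wpM2l; first by rewrite exprn_ge0.
  by rewrite lef_pV2 ?posrE ?exprn_gt0 ?ler_eXn2l //; lra.
apply: cvg_big => [|j _]; first exact: mul_continuous.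
have E i : #|F|%:R ^- (i * (d j).+1) = (#|F|%:R ^+ (d j).+1) ^- i :> K.
  by rewrite mulnC exprM.
under [X in infinite_product X]funext => i do rewrite E.
exact/cvg_sum_euler/card_finField_exp_ge2.
Qed.
End Limit.

Local Open Scope quotient_scope.

(** * Reduction modulo the maximal ideal *)

Section LocalRing.
Variables (R : idomainType) (m : idealr R).

Lemma idealr_of_closed (S : {pred R}) :
  idealr_closed S -> {I : idealr R | I =i S}.
Proof. by move=> clS; exists (HB.pack_for (idealr R) S (isIdealr.Build R S clS)). Qed.

Lemma idealr_nonunit (I : idealr R) a : a \in I -> a \isn't a GRing.unit.
Proof.
move=> aI; apply/negP => ua; have : 1 \in I by rewrite -(mulVr ua) idealMr.
by rewrite idealr1.
Qed.

Lemma nonunit_maximal_ideal (a : R) : a \isn't a GRing.unit ->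
  exists2 M : idealr R, maximal_ideal M & a \in M.
Proof.
move=> nua.
(* [Zorn_bigcup] includes the empty chain, so [set0] has to satisfy [P]. *)
pose P (S : set R) := [/\ forall c u v, S u -> S v -> S (c * u + v), ~ S 1
  & forall x, S x -> S a].
have PaR : P [set x | exists b, x = b * a].
  split=> [c _ _ [u ->] [v ->] | [b ba] | _ _].
  - by exists (c * u + v); rewrite mulrDl mulrA.
  - by move/negP: nua; apply; apply/unitrP; exists b; rewrite [a * b]mulrC -ba.
  - by exists 1; rewrite mul1r.
have [F FP totF | S [[clS S1 Sa] maxS]] := @Zorn_bigcup R P.
  split=> [c u v [A FA Au] [B FB Bv] | [A FA A1] | x [A FA Ax]].
  - have [AB | BA] := totF A B FA FB.
      by exists B => //; have [clB _ _] := FP _ FB; apply: clB => //; exact: AB.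
    by exists A => //; have [clA _ _] := FP _ FA; apply: clA => //; exact: BA.
  - by have [] := FP _ FA.
  - by exists A => //; have [_ _] := FP _ FA; apply; exact: Ax.
have {}Sa : S a.
  (* An empty [S] would lie strictly inside the ideal generated by [a], against maximality. *)
  have [[x Sx] | S0] := pselect (exists x, S x); first exact: Sa Sx.
  exfalso; apply: (maxS _ _ PaR); split.
    by move=> x Sx; case: S0; exists x.
  by move=> /(_ a) sub; apply: S0; exists a; apply: sub; exists 1; rewrite mul1r.
have [M ME] : {I : idealr R | I =i [pred x | `[< S x >]]}.
  apply: idealr_of_closed; split.
  - by apply/asboolP; rewrite -(subrr a) addrC -mulN1r; exact: clS.
  - by apply/negP => /asboolP.
  - by move=> c u v /asboolP Su /asboolP Sv; apply/asboolP; exact: clS.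
exists M; last by rewrite ME; apply/asboolP.
move=> I MI x; apply/idP/idP => [xI|/MI//]; apply/negPn/negP => xM.
apply: (maxS [set y | y \in I]).
  split=> [y Sy | /(_ x xI) Sx]; first by apply: MI; rewrite ME; apply/asboolP.
  by move/negP: xM; apply; rewrite ME; apply/asboolP.
split=> [c u v uI vI | | _ _] /=.
- by rewrite rpredD // idealMr.
- by rewrite idealr1.
- by apply: MI; rewrite ME; apply/asboolP.
Qed.

(** A nonunit lies in some maximal ideal, and [m] is the only one. *)
Lemma local_ring_unit (a : R) : local_ring m ->
  (a \is a GRing.unit) = (a \notin m).
Proof.
move=> [maxm uniqm]; apply/idP/idP => [ua | ].
  by apply: contraL ua => /idealr_nonunit.
apply: contraNT => /nonunit_maximal_ideal [M /uniqm Mm aM].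
by rewrite -Mm.
Qed.
End LocalRing.

(** * Vanishing of the cokernel *)

Section Cokernel.
Variables (R : comUnitRingType) (n : nat).

(** Preimages of the basis vectors are the columns of a right inverse, which is two-sided for a
    square matrix over a commutative ring. *)
Lemma coker_eq0 (B : 'M[R]_n) : (forall x : coker B, x = 0) <-> B \in unitmx.
Proof.
have pi0 v : (\pi_(coker B) v = 0) <-> v \in mximage B.
  have -> : (v \in mximage B) = (\pi_(coker B) v == \pi_(coker B) 0).
    by rewrite -Quotient.idealrBE subr0.
  by rewrite raddf0; split=> /eqP.
split=> [triv | unitB x].
  have /choice [f fP] : forall j : 'I_n, exists u : 'cV[R]_n, B *m u = delta_mx j 0.
    by move=> j; have /pi0 /asboolP [u ->] := triv (\pi_(coker B) (delta_mx j 0)); exists u.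
  have /mulmx1_unit [] // : B *m (\matrix_(i, j) f j i 0) = 1%:M.
  apply/matrixP => i j; have /colP /(_ i) := fP j; rewrite !mxE eqxx andbT => <-.
  by apply: eq_bigr => k _; rewrite mxE.
rewrite -[x]reprK; apply/pi0/asboolP; exists (invmx B *m repr x).
by rewrite mulKVmx.
Qed.
End Cokernel.

(** * Haar measure of events that depend only on the residue *)

Section Residue.
Variables (R : idomainType) (m : idealr R) (F : finFieldType).
Variable rho : {rmorphism R -> F}.
Hypothesis rho_eq0 : forall a, (rho a == 0) = (a \in m).
Hypothesis rho_surj : forall y, exists a, rho a = y.

Lemma unitmx_residue n (B : 'M[R]_n) : local_ring m ->
  (B \in unitmx) = (map_mx rho B \in unitmx).
Proof.
by move=> locm; rewrite !unitmxE det_map_mx (local_ring_unit _ locm) unitfE rho_eq0.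
Qed.

Lemma map_mx_surj k n (B : 'M[F]_(k, n)) : exists A, map_mx rho A = B.
Proof.
have [f fP] := choice rho_surj; exists (map_mx f B).
by apply/matrixP => i j; rewrite !mxE fP.
Qed.

Lemma ideal_exp1 x : ideal_exp m 1 x -> x \in m.
Proof.
move=> [s sm ->]; rewrite big_seq; apply: rpred_sum => p /sm [pm _].
by rewrite mulrC idealMr.
Qed.

Definition residue_fibre n (B : 'M[F]_n) : set 'M[R]_n := [set A | map_mx rho A = B].

Lemma translate_residue_fibre n (A : 'M[R]_n) (B : 'M[F]_n) :
  [set A + Y | Y in residue_fibre B] = residue_fibre (map_mx rho A + B).
Proof.
apply/seteqP; split=> [_ [Y YB <-] | X XB].
  by rewrite /residue_fibre /= map_mxD YB.
exists (X - A); last by rewrite addrC subrK.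
by rewrite /residue_fibre /= map_mxB XB addrC addKr.
Qed.

(** The fibre is open: around each of its points it contains the ball of matrices congruent modulo
    [m]. *)
Lemma measurable_residue_fibre n (B : 'M[F]_n) :
  measurable (residue_fibre B : set (borel_mx m n)).
Proof.
apply: sub_sigma_algebra; rewrite openE => A /= AB.
exists (fun i j => [set x | ideal_exp m 1 ((A i j : R) - (x : R))]) => [i j|X XA].
  rewrite -nbhs_entourageE; exists [set p | ideal_exp m 1 ((p.1 : R) - p.2)].
    by exists 1.
  by move=> x /xsectionP.
apply/matrixP => i j; rewrite -AB !mxE; apply/eqP.
rewrite eq_sym -subr_eq0 -rmorphB rho_eq0.
exact/ideal_exp1/XA.
Qed.

Variables (K : realType) (n : nat) (mu : probability (borel_mx m n) K).
Hypothesis haar_mu : haar_probability mu.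

(** Translation by a lift of [B] carries the fibre over 0 to the fibre over [B]. *)
Lemma haar_residue_fibre (B : 'M[F]_n) : mu (residue_fibre B) = mu (residue_fibre 0).
Proof.
have [A AB] := map_mx_surj B.
rewrite -(haar_mu A (measurable_residue_fibre 0)).
by rewrite (translate_residue_fibre A 0) AB addr0.
Qed.

Let residue_event (s : seq 'M[F]_n) : set (borel_mx m n) :=
  [set A | map_mx rho (A : 'M[R]_n) \in s].

(** Duplicate-free lists turn finite additivity into an induction that adds one disjoint fibre at a
    time. *)
Let haar_residue_seq (s : seq 'M[F]_n) : uniq s ->
  measurable (residue_event s) /\
  mu (residue_event s) = ((size s)%:R%:E * mu (residue_fibre 0))%E.
Proof.
elim: s => [_|B s IHs /= /andP [Bs /IHs [ms mus]]].
  rewrite (_ : residue_event _ = set0) ?measure0 ?mul0e //.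
  by apply/seteqP; split=> A.
have -> : residue_event (B :: s) = residue_fibre B `|` residue_event s.
  apply/seteqP; split=> A; rewrite /residue_event /residue_fibre /= inE.
    by case/orP => [/eqP|]; [left | right].
  by case=> [->|->]; rewrite ?eqxx ?orbT.
have mB : measurable (residue_fibre B : set (borel_mx m n)).
  exact: measurable_residue_fibre.
have disj : (residue_fibre B : set (borel_mx m n)) `&` residue_event s = set0.
  apply/seteqP; split=> A //= [AB]; rewrite /residue_event /=.
  by rewrite (AB : map_mx rho _ = B) (negbTE Bs).
split; first exact: measurableU.
have -> : mu (residue_fibre B `|` residue_event s) =
  (mu (residue_fibre B) + mu (residue_event s))%E by exact: measureU.
rewrite mus haar_residue_fibre -natr1 EFinD ge0_muleDl ?lee_fin //.
by rewrite mul1e addeC.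
Qed.

Lemma haar_residue_event (G : {set 'M[F]_n}) :
  mu [set A : 'M[R]_n | map_mx rho A \in G] =
  (#|G|%:R / #|F|%:R ^+ (n * n))%:E.
Proof.
have fin0 : mu (residue_fibre 0) \is a fin_num.
  by apply: fin_num_measure; exact: measurable_residue_fibre.
(* The list of all matrices gives the whole space, of mass 1, which fixes the mass of one fibre. *)
have total : (#|F|%:R ^+ (n * n) * fine (mu (residue_fibre 0)) = 1)%R.
  have [_] := haar_residue_seq (enum_uniq 'M[F]_n).
  rewrite (_ : residue_event _ = setT); last first.
    by apply/seteqP; split=> A // _; rewrite /residue_event /= mem_enum.
  rewrite probability_setT -cardE card_mx natrX -(fineK fin0) -EFinM.
  by case=> <-.
have [_] := haar_residue_seq (enum_uniq G).
rewrite (_ : residue_event _ = [set A : 'M[R]_n | map_mx rho A \in G]); last first.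
  by apply/seteqP; split=> A; rewrite /residue_event /= mem_enum.
rewrite -cardE -(fineK fin0) -EFinM => ->; congr (_%:E).
have q_neq0 : (#|F|%:R ^+ (n * n) : K) != 0.
  by apply/eqP => q0; move: total; rewrite q0 mul0r => /esym/eqP; rewrite oner_eq0.
by congr (_ * _); apply: (mulfI q_neq0); rewrite total divff.
Qed.
End Residue.

(** * Companion matrices and the conclusion *)

Lemma companion_exists (F : fieldType) (p : {poly F}) d :
  p \is monic -> size p = d.+2 -> {C : 'M[F]_d.+1 | char_poly C = p}.
Proof.
move=> monp szp; have szE : (size p).-1 = d.+1 by rewrite szp.
(* The companion matrix has size [(size p).-1]; eliminating [szE] gives it a successor size. *)
by move: (companionmxK monp); case: _ / szE; exists (companionmx p).
Qed.

Local Close Scope quotient_scope.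

Theorem theorem2 (K : realType) (R : idomainType) (m : idealr R)
    (hdvr : discrete_valuation_ring m) (hcomplete : adically_complete m)
    (F : finFieldType) (phi : {rmorphism {ideal_quot m} -> F})
    (hphi : bijective phi)
    (r : nat) (P : 'I_r -> {poly R})
    (hmonic : forall j, P j \is monic)
    (hirr : forall j, irreducible_poly (reduction phi (P j)))
    (hdist : injective (fun j => reduction phi (P j)))
    (mu : forall n : nat, probability (borel_mx m n) K)
    (hmu : forall n, haar_probability (mu n)) :
  (fun n : nat => mu n.+1 [set A : 'M[R]_n.+1 |
     forall j : 'I_r, forall x : coker (horner_mx A (P j)), x = 0])
    @ \oo -->
  (\prod_(j < r) infinite_product
     (fun i => 1 - (#|F|%:R : K) ^- (i * (size (P j)).-1)))%:E.
Proof.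
have [_ locm _] := hdvr; have [psi phiK psiK] := hphi.
pose rho : {rmorphism R -> F} := phi \o (\pi_{ideal_quot m})%qT.
have rho_eq0 a : (rho a == 0) = (a \in m).
  rewrite -[a in RHS]subr0 Quotient.idealrBE raddf0 /= -(can_eq phiK).
  by rewrite rmorph0.
have rho_surj y : exists a, rho a = y.
  by exists (repr (psi y)); rewrite /= reprK psiK.
have monred j : reduction phi (P j) \is monic by exact: (monic_map rho (hmonic j)).
have szred j : size (reduction phi (P j)) = size (P j).
  apply: (@size_map_poly_id0 _ _ rho); rewrite (monicP (hmonic j)) rmorph1.
  exact: oner_neq0.
pose d j := (size (P j)).-2.
(* An irreducible polynomial has size at least 2, so [.-2] truncates nothing. *)
have dE j : size (reduction phi (P j)) = (d j).+2.
  by have [] := hirr j; rewrite szred /d; case: (size _) => [|[]].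
pose C j := sval (companion_exists (monred j) (dE j)).
have CE j : char_poly (C j) = reduction phi (P j) by rewrite /C; case: companion_exists.
have irrC j : irreducible_poly (char_poly (C j)) by rewrite CE.
have injC : injective (fun j => char_poly (C j)).
  by move=> i j; rewrite !CE; exact: hdist.
have eventE n : mu n.+1 [set A : 'M[R]_n.+1 |
     forall j : 'I_r, forall x : coker (horner_mx A (P j)), x = 0] =
   (#|[set A : 'M[F]_n.+1 |
        [forall j, horner_mx A (char_poly (C j)) \in unitmx]]%SET|%:R
     / #|F|%:R ^+ (n.+1 * n.+1))%:E.
  rewrite -(haar_residue_event rho_eq0 rho_surj (hmu n.+1)); congr (mu _ _).
  (* Evaluation at a matrix commutes with [rho], and [unitmx_residue] detects invertibility on
     residues. *)
  have unitE (A : 'M[R]_n.+1) j : (horner_mx A (P j) \in unitmx) =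
      (horner_mx (map_mx rho A) (char_poly (C j)) \in unitmx).
    by rewrite (unitmx_residue rho_eq0 _ locm) map_horner_mx CE.
  apply/seteqP; split=> A /=; rewrite inE.
    by move=> trivA; apply/forallP => j; rewrite -unitE; apply/coker_eq0/trivA.
  by move=> /forallP unitA j; apply/coker_eq0; rewrite unitE.
under eq_cvg do rewrite eventE.
apply: cvg_EFin; first exact: nearW.
have -> : \prod_(j < r) infinite_product
     (fun i => 1 - (#|F|%:R : K) ^- (i * (size (P j)).-1)) =
  \prod_(j < r) infinite_product (fun i => 1 - (#|F|%:R : K) ^- (i * (d j).+1)).
  by apply: eq_bigr => j _; rewrite -szred dE.
exact: cvg_unit_probability.
Qed.
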